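(* Let $q$ be an integer with $q\neq -1$. Let $S$ be a nonempty finite subset of the right-ordered group $\mathrm{BS}(1,q)$ with $|S|=k\geq 5$ and $e=\min(S)$. If $|S^{2}|=3k-3$, then either $\langle S\rangle$ is an abelian subgroup, or there exist elements $x,g\in\mathrm{BS}(1,q)$ such that $$S=\{e,x,xg,xg^{2},xg^{3},\ldots,xg^{k-2}\},$$ with $xg\neq gx$ and $(xg^{i})^{2}=x^{2}$ for each $0\leq i\leq k-2$.
   Context: $\mathrm{BS}(1,q)=\langle a,b\mid ab=b^{q}a\rangle$ is the Baumslag-Solitar group, with identity $e$. It is regarded as a right-ordered group, that is, it is equipped with a fixed total order $\leq$ such that $x\leq y$ implies $xz\leq yz$ for all $x,y,z$ (no further property of the order is specified); $\min(S)$ is taken with respect to this order. $S^{2}=\{s_{1}s_{2}: s_{1},s_{2}\in S\}$, and $\langle S\rangle$ is the subgroup generated by $S$. *)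

(* Defs.v *)
From HB Require Import structures.
From mathcomp Require Import all_boot all_order all_algebra finmap.
From mathcomp Require Import boolp classical_sets.

Set Implicit Arguments.
Unset Strict Implicit.
Unset Printing Implicit Defensive.

Local Open Scope quotient_scope.

Section Presentation.
Variable X : choiceType.

(* The letter (x, true) is the generator x and (x, false) is its inverse. *)
Definition word := seq (X * bool).

Definition inv_letter (l : X * bool) : X * bool := (l.1, ~~ l.2).
Definition inv_word (w : word) : word := rev (map inv_letter w).

(* [R u v] is the defining relation u = v; [word_eq R] is the least congruence
   on words that contains the defining relations and cancels x x^-1, x^-1 x. *)
Inductive word_eq (R : word -> word -> Prop) : word -> word -> Prop :=
| WeqRefl u : word_eq R u u
| WeqSym u v : word_eq R u v -> word_eq R v u
| WeqTrans u v w : word_eq R u v -> word_eq R v w -> word_eq R u w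
| WeqCat u u' v v' :
    word_eq R u u' -> word_eq R v v' -> word_eq R (u ++ v) (u' ++ v')
| WeqCancel l : word_eq R [:: l; inv_letter l] [::]
| WeqRel u v : R u v -> word_eq R u v.

Variable R : word -> word -> Prop.

Definition word_eqb (u v : word) : bool := `[< word_eq R u v >].

Lemma word_eqb_refl : reflexive word_eqb.
Proof. by move=> u; apply/asboolP; exact: WeqRefl. Qed.

Lemma word_eqb_sym : symmetric word_eqb.
Proof. by move=> u v; apply/asboolP/asboolP; exact: WeqSym. Qed.

Lemma word_eqb_trans : transitive word_eqb.
Proof.
by move=> v u w /asboolP uv /asboolP vw; apply/asboolP; exact: WeqTrans uv vw.
Qed.

Canonical word_equiv := EquivRel word_eqb word_eqb_refl word_eqb_sym word_eqb_trans.

Definition presented : Type := {eq_quot word_equiv}.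

HB.instance Definition _ : EqQuotient _ word_equiv presented := EqQuotient.on presented.
HB.instance Definition _ := Choice.on presented.

Definition of_word (w : word) : presented := \pi_presented w.

Lemma of_wordP u v : of_word u = of_word v <-> word_eq R u v.
Proof. by split=> [/eqmodP/asboolP|/asboolP ?]; last exact/eqmodP. Qed.

Lemma of_wordK (x : presented) : of_word (repr x) = x.
Proof. exact: reprK. Qed.

Lemma inv_letterK : involutive inv_letter.
Proof. by case=> x b; rewrite /inv_letter negbK. Qed.

Lemma word_eq_mulV u : word_eq R (u ++ inv_word u) [::].
Proof.
elim: u => [|l u IHu]; first exact: WeqRefl.
rewrite /inv_word /= rev_cons -cats1 -/(inv_word u) catA.
apply: WeqTrans (WeqCancel R l).
exact: (WeqCat (WeqCat (WeqRefl R [:: l]) IHu) (WeqRefl R [:: inv_letter l])).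
Qed.

Lemma inv_wordK : involutive inv_word.
Proof. by move=> u; rewrite /inv_word map_rev revK mapK //; exact: inv_letterK. Qed.

Lemma word_eq_Vmul u : word_eq R (inv_word u ++ u) [::].
Proof. by rewrite -{2}[u]inv_wordK; exact: word_eq_mulV. Qed.

Lemma word_eq_inv u v : word_eq R u v -> word_eq R (inv_word u) (inv_word v).
Proof.
move=> uv; apply: (WeqTrans (v := inv_word u ++ (v ++ inv_word v))).
  rewrite -{1}[inv_word u]cats0; apply: WeqCat; first exact: WeqRefl.
  exact/WeqSym/word_eq_mulV.
apply: (WeqTrans (v := (inv_word u ++ u) ++ inv_word v)).
  rewrite catA; apply/WeqSym/WeqCat; last exact: WeqRefl.
  by apply: WeqCat => //; exact: WeqRefl.
by rewrite -{2}[inv_word v]cat0s; apply: WeqCat; [exact: word_eq_Vmul | exact: WeqRefl].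
Qed.

Definition pres_one : presented := of_word [::].
Definition pres_mul (x y : presented) : presented := of_word (repr x ++ repr y).
Definition pres_inv (x : presented) : presented := of_word (inv_word (repr x)).

Lemma repr_of_word u : word_eq R (repr (of_word u)) u.
Proof. by apply/of_wordP; rewrite of_wordK. Qed.

Lemma pres_mulE u v : pres_mul (of_word u) (of_word v) = of_word (u ++ v).
Proof. by apply/of_wordP; apply: WeqCat; exact: repr_of_word. Qed.

Lemma pres_invE u : pres_inv (of_word u) = of_word (inv_word u).
Proof. by apply/of_wordP/word_eq_inv/repr_of_word. Qed.

Lemma pres_mulA : associative pres_mul.
Proof.
move=> x y z; rewrite -[x]of_wordK -[y]of_wordK -[z]of_wordK.
by rewrite !pres_mulE catA.
Qed.

Lemma pres_mul1 : left_id pres_one pres_mul.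
Proof. by move=> x; rewrite -[x]of_wordK pres_mulE cat0s. Qed.

Lemma pres_mulr1 : right_id pres_one pres_mul.
Proof. by move=> x; rewrite -[x]of_wordK pres_mulE cats0. Qed.

Lemma pres_mulVx : left_inverse pres_one pres_inv pres_mul.
Proof.
move=> x; rewrite -[x]of_wordK pres_invE pres_mulE.
by apply/of_wordP; exact: word_eq_Vmul.
Qed.

Lemma pres_mulxV : right_inverse pres_one pres_inv pres_mul.
Proof.
move=> x; rewrite -[x]of_wordK pres_invE pres_mulE.
by apply/of_wordP; exact: word_eq_mulV.
Qed.

HB.instance Definition _ := isGroup.Build presented
  pres_mulA pres_mul1 pres_mulr1 pres_mulVx pres_mulxV.

End Presentation.

(* Generators: [true] is a and [false] is b. *)
Definition bs_a : word bool := [:: (true, true)].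
Definition bs_bpow (q : int) : word bool :=
  match q with
  | Posz n => nseq n (false, true)
  | Negz n => nseq n.+1 (false, false)
  end.

Inductive bs_rel (q : int) : word bool -> word bool -> Prop :=
| BSRel : bs_rel q (bs_a ++ bs_bpow 1) (bs_bpow q ++ bs_a).

Definition BS (q : int) : groupType := presented (bs_rel q).

Local Open Scope group_scope.

Definition right_order (G : groupType) (le : rel G) : Prop :=
  [/\ reflexive le, antisymmetric le, transitive le, total le
    & forall x y z : G, le x y -> le (x * z) (y * z)].

Definition is_min (T : choiceType) (le : rel T) (S : {fset T}) (m : T) : Prop :=
  m \in S /\ {in S, forall s, le m s}.

Definition fset_sq (G : groupType) (S : {fset G}) : {fset G} :=
  [fset s1 * s2 | s1 in S, s2 in S]%fset.

Definition generated (G : groupType) (S : {fset G}) : set G :=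
  smallest (fun H : set G => group_closed [in H]) [set` S]%classic.

(* Main.v *)
Require Import Defs.
From mathcomp Require Import all_boot all_order all_algebra finmap.
From mathcomp Require Import boolp classical_sets.
From mathcomp Require Import zify ring lra.

(* For q = 0 and q = 1 the group is abelian. Otherwise |q| > 1 and BS(1,q) acts
   faithfully on the rationals by maps u |-> q^h u + t, and every finite S with
   1 in S whose elements do not all commute satisfies |S^2| >= 3|S| - 2, so only
   the first alternative can occur. This is proved by induction on |S|. Let A be
   the layer of S of largest h, say h = n (up to inverting S, n > 0), and let T
   be the rest. The top layer of S^2 is A^2, of size at least 3|A| - 2 because
   a dilated sumset B + q^n B has at least 3|B| - 2 elements. Strictly below it one
   finds enough products outside T^2: if T is not commutative, two products xz, zx
   suffice by induction; if T is commutative then |T^2| >= 2|T| - 1 and |T| + 1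
   products of an element of A with an element of T suffice. *)

Set Implicit Arguments.
Unset Strict Implicit.
Unset Printing Implicit Defensive.

Import Order.TTheory GRing.Theory Num.Theory.

(** * Sumsets in ordered rings *)

Lemma exists_fset_max d (T : choiceType) (R : orderType d) (f : T -> R)
    (A : {fset T}) :
  A != fset0 -> exists2 x, x \in A & {in A, forall y, (f y <= f x)%O}.
Proof.
case/fset0Pn => x0 Ax0.
suff [x xA xmax] : exists2 x, x \in (A : seq T)
    & {in (A : seq T), forall y, (f y <= f x)%O} by exists x.
have: x0 \in (A : seq T) by [].
elim: (A : seq T) x0 {Ax0} => // a s IHs x0 _.
case: s IHs => [_|b s IHs].
  by exists a => [|y]; rewrite inE // => /eqP->.
have [x xs xmax] := IHs b (mem_head _ _).
case: (leP (f a) (f x)) => fax.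
  exists x => [|y]; first by rewrite inE xs orbT.
  by rewrite inE => /predU1P[->|/xmax].
exists a => [|y]; first exact: mem_head.
rewrite inE => /predU1P[->//|/xmax fy].
exact/ltW/(le_lt_trans fy).
Qed.

Lemma leq_card_disjoint (T : choiceType) (A B C : {fset T}) :
  (A `<=` C)%fset -> (B `<=` C)%fset -> {in A, forall x, x \notin B} ->
  (#|` A| + #|` B| <= #|` C|)%N.
Proof.
move=> AC BC AB; rewrite -cardfsUI.
have /eqP-> : (A `&` B == fset0)%fset by rewrite fsetI_eq0; exact/fdisjointP.
rewrite cardfs0 addn0; apply/fsubset_leq_card.
by rewrite fsubUset AC.
Qed.

Lemma card_fset_split (T : choiceType) (P : pred T) (A : {fset T}) :
  #|` A| = (#|` [fset x in A | P x]%fset| + #|` [fset x in A | ~~ P x]%fset|)%N.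
Proof.
rewrite -(cardfsID [fset x in A | P x]%fset A); congr (_ + _)%N.
  by congr #|` _|; apply/fsetP => x; rewrite !inE; case: (x \in A).
by congr #|` _|; apply/fsetP => x; rewrite !inE; case: (x \in A); rewrite ?andbT.
Qed.

(** The translates [A + min B] and [max A + B] both lie in [C] and meet only in [max A + min B]. *)
Lemma card_sumset (R : realDomainType) (A B C : {fset R}) :
  A != fset0 -> B != fset0 -> {in A & B, forall a b, (a + b)%R \in C} ->
  (#|` A| + #|` B| <= #|` C| + 1)%N.
Proof.
move=> A0 B0 ABC.
have [a aA amax] := exists_fset_max id A0.
have [b bB bmin] := exists_fset_max (fun b : R => - b)%R B0.
pose A' := [fset (x + b)%R | x in A]%fset; pose B' := [fset (a + y)%R | y in B]%fset.
have <- : #|` A'| = #|` A| by rewrite card_imfset //; exact: addIr.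
have <- : #|` B'| = #|` B| by rewrite card_imfset //; exact: addrI.
rewrite -cardfsUI leq_add //.
  apply/fsubset_leq_card/fsubsetP => z.
  by rewrite !inE => /orP[] /imfsetP[y /= yA ->]; exact: ABC.
rewrite -(cardfs1 (a + b)%R); apply/fsubset_leq_card/fsubsetP => z.
rewrite !inE => /andP[/imfsetP[x /= xA ->] /imfsetP[y /= yB e]].
by apply/eqP; move: (amax _ xA) (bmin _ yB); lra.
Qed.

Lemma common_denominator (s : seq rat) :
  exists2 d : int, d != 0%R & {in s, forall u, (d%:~R * u)%R \is a Num.int}.
Proof.
elim: s => [|u s [d d0 ds]]; first by exists 1%R.
exists (d * denq u)%R => [|v]; first by rewrite mulf_neq0 ?denq_neq0.
rewrite inE intrM => /predU1P[->|/ds vs].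
  by rewrite -mulrA [(_ * u)%R]mulrC -numqE rpredM // intr_int.
by rewrite mulrAC rpredM // intr_int.
Qed.

(* Take the finest coset of a scaled copy [z^j Z / d] containing [A]: it
   contains at least two classes modulo [z^(j+1) Z / d], and the class of
   [a + z b] is the class of [a], so these classes contribute disjointly. *)
Lemma card_sumset_dilate (z : int) (A C : {fset rat}) :
  (1 < `|z|)%R -> A != fset0 ->
  {in A &, forall a b, (a + z%:~R * b)%R \in C} ->
  (3 * #|` A| <= #|` C| + 2)%N.
Proof.
move=> z1 A0 AC; have [a0 a0A] := fset0Pn _ A0.
have z0 : (z%:~R != 0 :> rat)%R by rewrite intr_eq0; apply/eqP => e; move: z1; rewrite e.
have [->|Aa0] := eqVneq A [fset a0]%fset.
  rewrite cardfs1 /= addn2 !ltnS cardfs_gt0; apply/fset0Pn.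
  by eexists; exact: (AC _ _ a0A a0A).
have [w wA wa0] : exists2 w, w \in A & w != a0.
  have: ~~ (A `<=` [fset a0])%fset by rewrite fsubset1 negb_or Aa0.
  by case/fsubsetPn => w wA; rewrite inE; exists w.
have [d d0 dA] := common_denominator [seq u - a0 | u <- A]%R.
(* [H j] is membership in the subgroup [(z^j / d) Z] of the rationals. *)
pose H j (u : rat) := (d%:~R * u / z%:~R ^+ j)%R \is a Num.int.
have HD j u v : H j u -> H j (u + v)%R = H j v.
  by move=> Hu; rewrite /H mulrDr mulrDl rpredDl.
have Hz j u : H j.+1 (z%:~R * u)%R = H j u.
  by rewrite /H mulrCA exprS invfM mulrACA divff // mul1r.
(* The nonzero number [d (w - a0)] has absolute value below [2^j <= |z|^j] for [j] large, so its
   quotient by [z^j] cannot be a nonzero integer. *)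
have exj : exists j, ~~ all (fun u => H j (u - a0)%R) A.
  pose x : rat := (`|d%:~R * (w - a0)|)%R; pose j := Num.bound x.
  exists j; apply/allPn; exists w => //; apply/negP => /norm_intr_ge1.
  have d0' : (d%:~R != 0 :> rat)%R by rewrite intr_eq0.
  rewrite !mulf_neq0 ?invr_eq0 ?expf_neq0 ?subr_eq0 //.
  move=> /(_ isT); rewrite normf_div normrX ler_pdivlMr ?exprn_gt0 ?normr_gt0 //.
  rewrite mul1r leNgt => /negP; apply; apply: (lt_le_trans (upper_nthrootP (leqnn j))).
  by rewrite lerXn2r ?nnegrE ?normr_ge0 // -intr_norm (ler_int _ 2); lia.
(* Level [0] is excluded by the choice of [d]. By minimality all differences [u - a0] satisfy [H j],
   while [a0] and [v] differ at level [j + 1]. *)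
case: (ex_minnP exj) => -[|j] /allPn[v vA vH] jmin.
  by move: vH; rewrite /H expr0 divr1 dA //; apply/mapP; exists v.
have HA u : u \in A -> H j (u - a0)%R.
  by move: u; apply/allP/negPn/negP => /jmin; rewrite ltnn.
pose P u := H j.+1 (u - a0)%R.
pose A1 := [fset u in A | P u]%fset; pose A2 := [fset u in A | ~~ P u]%fset.
pose C1 := [fset u in C | H j.+1 (u - a0 - z%:~R * a0)%R]%fset.
pose C2 := [fset u in C | ~~ H j.+1 (u - a0 - z%:~R * a0)%R]%fset.
have cosetE u b : b \in A -> H j.+1 (u + z%:~R * b - a0 - z%:~R * a0)%R = P u.
  move=> bA; rewrite /P.
  have -> : (u + z%:~R * b - a0 - z%:~R * a0 = z%:~R * (b - a0) + (u - a0))%R by ring.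
  by apply: HD; rewrite Hz HA.
have cA : (#|` A1| + #|` A2| = #|` A|)%N.
  by rewrite -(card_fset_split P).
have cC : (#|` C1| + #|` C2| <= #|` C|)%N.
  by rewrite (card_fset_split (fun u => H j.+1 (u - a0 - z%:~R * a0)%R) C).
have A10 : A1 != fset0.
  by apply/fset0Pn; exists a0; rewrite !inE a0A /P subrr /H mulr0 mul0r rpred0.
have A20 : A2 != fset0 by apply/fset0Pn; exists v; rewrite !inE vA.
have zinj : injective ( *%R z%:~R : rat -> rat) by exact: mulfI.
pose B := [fset z%:~R * b | b in A]%R%fset.
have cB : #|` B| = #|` A| by rewrite card_imfset.
have B0 : B != fset0 by rewrite -cardfs_gt0 cB cardfs_gt0.
have le1 : (#|` A1| + #|` B| <= #|` C1| + 1)%N.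
  apply: card_sumset => // u _ + /imfsetP[b /= bA ->]; rewrite !inE => /andP[uA Pu].
  by rewrite AC // cosetE.
have le2 : (#|` A2| + #|` B| <= #|` C2| + 1)%N.
  apply: card_sumset => // u _ + /imfsetP[b /= bA ->]; rewrite !inE => /andP[uA Pu].
  by rewrite AC // cosetE.
by lia.
Qed.

Local Open Scope group_scope.

(** * Product sets in groups of affine maps *)

Definition commuting_set (G : groupType) (S : {fset G}) : Prop :=
  {in S &, forall x y, x * y = y * x}.

Section AffineGroup.
(** The element [x] stands for the affine map [u |-> Q ^ h x * u + t x]: [hM] and [tM] describe
    composition, and [ht_inj] says that the action is faithful. *)
Variables (G : groupType) (q : int) (h : G -> int) (t : G -> rat).
Local Notation Q := (q%:~R : rat).
Hypothesis q_gt1 : (1 < `|q|)%R.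
Hypothesis hM : forall x y, h (x * y) = (h x + h y)%R.
Hypothesis tM : forall x y, t (x * y) = (t x + Q ^ h x * t y)%R.
Hypothesis ht_inj : forall x y, h x = h y -> t x = t y -> x = y.

Lemma height1 : h 1 = 0%R.
Proof. by apply: (@addrI _ (h 1)); rewrite -hM mulg1 addr0. Qed.

Lemma heightV x : h x^-1 = (- h x)%R.
Proof. by apply: (@addrI _ (h x)); rewrite -hM mulgV height1 subrr. Qed.

Lemma translation1 : t 1 = 0%R.
Proof. by move: (tM 1 1); rewrite mulg1 height1 expr0z; lra. Qed.

Lemma ratio_neq0 : Q != 0%R.
Proof. by rewrite intr_eq0; apply/eqP => q0; move: q_gt1; rewrite q0. Qed.

Lemma ratio_expz_gt1 (n : int) : (0 < n)%R -> (1 < `|Q ^ n|)%R.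
Proof.
case: n => // n n0; rewrite -exprnP normrX exprn_egt1 -?lt0n //.
by rewrite -intr_norm (ltr_int _ 1).
Qed.

Lemma ratio_expz_eq1 (n : int) : n != 0%R -> (Q ^ n != 1)%R.
Proof.
move=> n0; apply/eqP => e; case: (ltrgt0P n) n0 => // hn _.
  by move: (ratio_expz_gt1 hn); rewrite e normr1 ltxx.
have := @ratio_expz_gt1 (- n)%R; rewrite oppr_gt0 -invr_expz e invr1 normr1 ltxx.
by move/(_ hn).
Qed.

(** Comparing translations in [x y = y x] gives [(Q ^ h x - 1) t y = (Q ^ h y - 1) t x]. Since
    [Q ^ h x] differs from [1], [h y] determines [t y]. *)
Lemma centralizer_height_inj x y z :
  h x != 0%R -> x * y = y * x -> x * z = z * x -> h y = h z -> y = z.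
Proof.
move=> hx /(congr1 t) + /(congr1 t) + hyz; rewrite !tM hyz => ey ez.
apply: ht_inj => //; have := ratio_expz_eq1 hx.
rewrite -subr_eq0 => /mulfI; apply; lra.
Qed.

(** Both [y * z] and [z * y] centralize [x], and they have the same height. *)
Lemma centralizer_commute x y z :
  h x != 0%R -> x * y = y * x -> x * z = z * x -> y * z = z * y.
Proof.
move=> hx xy xz; apply: (@centralizer_height_inj x) => //.
- exact: (@commuteM _ x y z).
- exact: (@commuteM _ x z y).
- by rewrite !hM addrC.
Qed.

(** On a layer of height [n] the translation of [x * y] is [t x + Q ^ n * t y], so the products form
    a sumset of rationals. *)
Lemma card_mul_layers (n m : int) (X Y Z : {fset G}) :
  X != fset0 -> Y != fset0 ->
  {in X, forall x, h x = n} -> {in Y, forall y, h y = m} ->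
  {in X & Y, forall x y, x * y \in Z} ->
  (#|` X| + #|` Y| <= #|` Z| + 1)%N.
Proof.
move=> X0 Y0 Xn Ym XYZ.
pose A := [fset t x | x in X]%fset; pose B := [fset (Q ^ n * t y)%R | y in Y]%fset.
pose C := [fset t z | z in Z]%fset.
have <- : #|` A| = #|` X|.
  by rewrite card_in_imfset // => x y xX yX; apply: ht_inj; rewrite !Xn.
have <- : #|` B| = #|` Y|.
  rewrite card_in_imfset // => x y xX yX /(mulfI (expfz_neq0 _ ratio_neq0)).
  by apply: ht_inj; rewrite !Ym.
apply: (@leq_trans (#|` C| + 1)); last by rewrite leq_add2r leq_imfset_card.
apply: card_sumset.
- by case/fset0Pn: X0 => x xX; apply/fset0Pn; exists (t x); apply: in_imfset.
- case/fset0Pn: Y0 => y yY; apply/fset0Pn; exists (Q ^ n * t y)%R.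
  by apply: (in_imfset _ (fun y => Q ^ n * t y)%R).
move=> _ _ /imfsetP[x /= xX ->] /imfsetP[y /= yY ->].
by rewrite -(Xn _ xX) -tM; apply: in_imfset; exact: XYZ.
Qed.

Lemma mem_fset_sq (S : {fset G}) x y : x \in S -> y \in S -> x * y \in fset_sq S.
Proof. by move=> xS yS; apply: in_imfset2. Qed.

Lemma fset_sqP (S : {fset G}) z :
  reflect (exists2 p, p.1 \in S /\ p.2 \in S & z = p.1 * p.2) (z \in fset_sq S).
Proof.
apply: (iffP idP) => [/imfset2P[x /= xS [y /= yS ->]]|[[x y] /= [xS yS] ->]].
  by exists (x, y).
exact: mem_fset_sq.
Qed.

(** Translations identify the square of the layer with a sum [A + q^n A], and [|q^n| > 1]. *)
Lemma card_sq_layer (n : int) (X : {fset G}) :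
  (0 < n)%R -> X != fset0 -> {in X, forall x, h x = n} ->
  (3 * #|` X| <= #|` fset_sq X| + 2)%N.
Proof.
case: n => // n n0 X0 Xn.
pose A := [fset t x | x in X]%fset; pose C := [fset t z | z in fset_sq X]%fset.
have <- : #|` A| = #|` X|.
  by rewrite card_in_imfset // => x y xX yX; apply: ht_inj; rewrite !Xn.
apply: (@leq_trans (#|` C| + 2)); last by rewrite leq_add2r leq_imfset_card.
apply: (@card_sumset_dilate (q ^+ n)).
- by rewrite normrX exprn_egt1 // -lt0n.
- by case/fset0Pn: X0 => x xX; apply/fset0Pn; exists (t x); apply: in_imfset.
move=> _ _ /imfsetP[x /= xX ->] /imfsetP[y /= yY ->].
rewrite rmorphXn /=; have -> : (Q ^+ n = Q ^ h x)%R by rewrite Xn.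
by rewrite -tM; apply: in_imfset; exact: mem_fset_sq.
Qed.

(** Heights carry the product set to a sumset of integers without shrinking [X]. *)
Lemma card_sq_height_inj (X : {fset G}) :
  X != fset0 -> {in X &, injective h} -> (2 * #|` X| <= #|` fset_sq X| + 1)%N.
Proof.
move=> X0 hinj.
pose A := [fset h x | x in X]%fset; pose C := [fset h z | z in fset_sq X]%fset.
have cA : #|` A| = #|` X| by rewrite card_in_imfset.
apply: (@leq_trans (#|` C| + 1)); last by rewrite leq_add2r leq_imfset_card.
have A0 : A != fset0.
  by case/fset0Pn: X0 => x xX; apply/fset0Pn; exists (h x); apply: in_imfset.
rewrite mul2n -addnn -cA; apply: card_sumset => //.
move=> _ _ /imfsetP[x /= xX ->] /imfsetP[y /= yX ->].
by rewrite -hM; apply: in_imfset; exact: mem_fset_sq.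
Qed.

(** Bookkeeping for the induction: [fset_sq A] has height [n + n], strictly above [fset_sq T] and
    the new products [E], so the three sizes add up. *)
Lemma card_sq_add_layer (n : int) (T A E : {fset G}) :
  (0 < n)%R -> A != fset0 ->
  {in T, forall x, (h x < n)%R} -> {in A, forall x, h x = n} ->
  {in E, forall e, (h e < n + n)%R} -> {in E, forall e, e \notin fset_sq T} ->
  (E `<=` fset_sq (T `|` A)%fset)%fset ->
  (3 * #|` T| <= #|` fset_sq T| + #|` E|)%N ->
  (3 * #|` (T `|` A)%fset| <= #|` fset_sq (T `|` A)%fset| + 2)%N.
Proof.
move=> n0 A0 Tn An En ET ES le3.
have leA := card_sq_layer n0 A0 An.
have [leTA _] := leq_card_fsetU T A.
have sqS (X Y : {fset G}) : (X `<=` Y)%fset -> (fset_sq X `<=` fset_sq Y)%fset.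
  move/fsubsetP=> XY; apply/fsubsetP => _ /fset_sqP[[x y] /= [xX yX] ->].
  by apply: mem_fset_sq; exact: XY.
have le1 : (#|` E| + #|` fset_sq T| <= #|` (E `|` fset_sq T)%fset|)%N.
  by apply: leq_card_disjoint => //; [exact: fsubsetUl | exact: fsubsetUr].
have le2 : (#|` fset_sq A| + #|` (E `|` fset_sq T)%fset| <= #|` fset_sq (T `|` A)%fset|)%N.
  apply: leq_card_disjoint.
  - exact/sqS/fsubsetUr.
  - by rewrite fsubUset ES; exact/sqS/fsubsetUl.
  move=> _ /fset_sqP[[x y] /= [xA yA] ->]; apply/negP; rewrite inE => /orP[/En|].
    by rewrite hM !An // ltxx.
  case/fset_sqP=> [[u v] /= [/Tn hu /Tn hv] /(congr1 h)].
  by rewrite !hM (An _ xA) (An _ yA); lia.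
lia.
Qed.

(** Induction step, in three cases: [T] is not commutative; [T] is commutative of height [0]; [T] is
    commutative and contains an element of nonzero height. *)
Lemma card_sq_split (n : int) (T A : {fset G}) :
  (0 < n)%R -> A != fset0 -> 1 \in T ->
  {in T, forall x, (h x < n)%R} -> {in A, forall x, h x = n} ->
  ~ commuting_set (T `|` A)%fset ->
  (~ commuting_set T -> (3 * #|` T| <= #|` fset_sq T| + 2)%N) ->
  (3 * #|` (T `|` A)%fset| <= #|` fset_sq (T `|` A)%fset| + 2)%N.
Proof.
move=> n0 A0 T1 Tn An noncomm IH.
have T0 : T != fset0 by apply/fset0Pn; exists 1.
have hxn0 x : x \in A -> h x != 0%R by move=> xA; rewrite An // gt_eqF.
have addE := @card_sq_add_layer n T A _ n0 A0 Tn An.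
have sqTA x y : x \in T -> y \in A -> x * y \in fset_sq (T `|` A)%fset.
  by move=> xT yA; rewrite mem_fset_sq // inE ?xT ?yA ?orbT.
have sqAT x y : x \in A -> y \in T -> x * y \in fset_sq (T `|` A)%fset.
  by move=> xA yT; rewrite mem_fset_sq // inE ?xA ?yT ?orbT.
have [x xA] := fset0Pn _ A0.
have [commT|ncommT] := pselect (commuting_set T); last first.
  (* Products in [T] of height [h x + h z] only involve elements of height
     greater than [h z], which lie in the centralizer of [x]. *)
  pose N := [fset z in T | x * z != z * x]%fset.
  have N0 : N != fset0.
    apply/eqP => N0; apply: ncommT => y z yT zT.
    have cT w : w \in T -> x * w = w * x.
      by move=> wT; have := in_fset0 w; rewrite -N0 !inE wT => /negbFE/eqP.
    exact: centralizer_commute (hxn0 _ xA) (cT _ yT) (cT _ zT).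
  have [z + zmax] := exists_fset_max h N0; rewrite !inE => /andP[zT xz].
  have centT w : w \in T -> (h z < h w)%R -> x * w = w * x.
    move=> wT hzw; apply/eqP; apply: contraTT hzw => xw.
    by rewrite -leNgt zmax // !inE wT.
  have notT e : x * e != e * x -> h e = (h x + h z)%R -> e \notin fset_sq T.
    move=> xe he; apply/negP => /fset_sqP[[u v] /= [uT vT] ee].
    move: xe he; rewrite ee hM (An _ xA) => /eqP xe he.
    apply: xe; apply: (@commuteM _ x u v); apply: centT => //.
      by have := Tn _ vT; lia.
    by have := Tn _ uT; lia.
  apply: (addE [fset x * z; z * x]%fset).
  - by move=> e; rewrite !inE => /orP[] /eqP->; rewrite hM (An _ xA); have := Tn _ zT; lia.
  - move=> e; rewrite !inE => /orP[] /eqP->; apply: notT; rewrite ?hM 1?addrC //.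
      by rewrite -!mulgA; apply: contra_neq xz => /mulgI.
    by rewrite !mulgA; apply: contra_neq xz => /mulIg.
  - by apply/fsubsetP => e; rewrite !inE => /orP[] /eqP->; [exact: sqAT | exact: sqTA].
  by rewrite cardfs2 xz; exact: IH.
(* If all of [T] has height [0], products of [T] with [A] have height [n] and so avoid
   [fset_sq T]. *)
have [Tker|] := pselect {in T, forall y, h y = 0%R}.
  have hE e : h e = n -> (h e < n + n)%R /\ e \notin fset_sq T.
    move=> he; split; first by lia.
    apply/negP => /fset_sqP[[u v] /= [/Tker hu /Tker hv] ee].
    by move: he; rewrite ee hM hu hv; lia.
  have leT : (2 * #|` T| <= #|` fset_sq T| + 1)%N.
    rewrite mul2n -addnn; apply: (card_mul_layers T0 T0 Tker Tker); exact: mem_fset_sq.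
  (* If [A] has at least two elements, the set [A T] has size at least [|A| + |T| - 1 >= |T| + 1].
     If [A] is a singleton, [T x] falls one short and an extra product [x z] is needed. *)
  case: (ltngtP #|` A| 1%N) => [|A2|/eqP/cardfs1P[x' Ax]].
  - by rewrite ltnS leqn0 cardfs_eq0 (negPf A0).
  - pose E : {fset G} := [fset a * y | a in A, y in T]%fset.
    have hEn e : e \in E -> h e = n.
      by case/imfset2P=> [a /= aA [y /= yT ->]]; rewrite hM (An _ aA) (Tker _ yT) addr0.
    apply: (addE E).
    + by move=> e /hEn/hE[].
    + by move=> e /hEn/hE[].
    + by apply/fsubsetP => _ /imfset2P[a /= aA [y /= yT ->]]; exact: sqAT.
    have := @card_mul_layers n 0%R A T E A0 T0 An Tker.
    have AE : {in A & T, forall a y, a * y \in E} by move=> a y aA yT; apply: in_imfset2.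
    move=> /(_ AE); lia.
  have {x'}Ax : A = [fset x]%fset.
    by rewrite Ax; congr [fset _]%fset; apply/eqP; rewrite eq_sym -in_fset1 -Ax.
  (* If [x T] were contained in [T x], multiplication by [Q ^ n] would map the translations of [T]
     into themselves. As [|Q ^ n| > 1], the largest absolute value among them would be [0], so [T]
     would be trivial and the whole set commutative. *)
  have [z zT xz] : exists2 z, z \in T & x * z \notin [fset y * x | y in T]%fset.
    apply: contrapT => /forall2NP conjT.
    have [z zT zmax] := exists_fset_max (fun y => `|t y|%R) T0.
    have tz0 : t z = 0%R.
      case: (conjT z) => [//|] /negP; rewrite negbK => /imfsetP[y /= yT].
      move/(congr1 t); rewrite !tM (Tker y) // expr0z mul1r (An _ xA) addrC.
      move/addIr => e; have := zmax _ yT; rewrite -e.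
      rewrite normrM => le; apply/eqP; rewrite -normr_le0 -(pmulr_rle0 _ (x := `|Q ^ n| - 1)%R).
        by rewrite mulrBl mul1r subr_le0.
      by rewrite subr_gt0 ratio_expz_gt1.
    have Tone y : y \in T -> y = 1.
      move=> yT; apply: ht_inj; first by rewrite height1 Tker.
      by have := zmax _ yT; rewrite tz0 normr0 normr_le0 translation1 => /eqP.
    apply: noncomm => u v; rewrite Ax !inE => /orP[/Tone->|/eqP->] /orP[/Tone->|/eqP->];
      by rewrite ?mulg1 ?mul1g.
  pose E : {fset G} := (x * z |` [fset y * x | y in T])%fset.
  have hEn e : e \in E -> h e = n.
    rewrite !inE => /orP[/eqP->|/imfsetP[y /= yT ->]];
      by rewrite hM (An _ xA) Tker // ?addr0 ?add0r.
  apply: (addE E).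
  - by move=> e /hEn/hE[].
  - by move=> e /hEn/hE[].
  - apply/fsubsetP => e; rewrite !inE => /orP[/eqP->|/imfsetP[y /= yT ->]].
      exact: sqAT.
    exact: sqTA.
  have -> : #|` E| = #|` T|.+1.
    by rewrite cardfsU1 xz card_imfset //; exact: mulIg.
  by lia.
move=> /existsNP[y /not_implyP[yT /eqP hy]].
(* Otherwise the whole set would centralize [y], which has nonzero height, and hence would be
   commutative. *)
have [x' x'A yx] : exists2 x, x \in A & y * x <> x * y.
  apply: contrapT => /forall2NP cA; apply: noncomm.
  have cS u : u \in (T `|` A)%fset -> y * u = u * y.
    rewrite inE => /orP[uT|uA]; first exact: commT.
    by case: (cA u) => // /contrapT.
  move=> u v /cS yu /cS; exact: centralizer_commute hy yu.
have hinj : {in T &, injective h}.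
  move=> u v uT vT; apply: (centralizer_height_inj hy); exact: commT.
have leT := card_sq_height_inj T0 hinj.
(* Elements of [fset_sq T] centralize [y], whereas [x' * w] and [w * x'] with [w] in [T] do not;
   hence [E] avoids [fset_sq T]. *)
pose E : {fset G} := (y * x' |` [fset x' * w | w in T])%fset.
have memE e : e \in E -> exists2 w, w \in T & e = x' * w \/ e = w * x'.
  by rewrite !inE => /orP[/eqP->|/imfsetP[w /= wT ->]]; [exists y; auto|exists w; auto].
have centsq u : u \in fset_sq T -> y * u = u * y.
  by case/fset_sqP=> [[u1 u2] /= [u1T u2T] ->]; apply: (@commuteM _ y); exact: commT.
apply: (addE E).
- by move=> _ /memE[w wT [->|->]]; rewrite hM (An _ x'A); have := Tn _ wT; lia.
- move=> _ /memE[w wT [->|->]]; apply/negP => /centsq; have := commT _ _ yT wT.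
    move=> yw; rewrite mulgA -[RHS]mulgA -yw mulgA => /mulIg; exact: yx.
  by move=> yw; rewrite mulgA yw -!mulgA => /mulgI; exact: yx.
- by apply/fsubsetP => _ /memE[w wT [->|->]]; [exact: sqAT | exact: sqTA].
have -> : #|` E| = (y * x' \notin [fset x' * w | w in T]%fset) + #|` T|.
  by rewrite cardfsU1 card_imfset //; exact: mulgI.
(* From [y * x' = x' * w] the heights of [w] and [y] agree, so [w = y] by injectivity of [h] on [T],
   against the choice of [x']. *)
suff -> : y * x' \notin [fset x' * w | w in T]%fset by lia.
apply/negP => /imfsetP[w /= wT e]; apply: yx; rewrite e; congr (_ * _).
by apply: hinj => //; move/(congr1 h): e; rewrite !hM; lia.
Qed.

(** * Inverse sets and the lower bound for noncommuting sets *)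

Definition fset_inv (S : {fset G}) : {fset G} := [fset x^-1 | x in S]%fset.

Lemma mem_fset_inv S x : (x \in fset_inv S) = (x^-1 \in S).
Proof.
apply/imfsetP/idP => [[y /= yS ->]|xS]; first by rewrite invgK.
by exists x^-1; rewrite ?invgK.
Qed.

Lemma card_fset_inv S : #|` fset_inv S| = #|` S|.
Proof. by rewrite card_imfset //; exact: invg_inj. Qed.

Lemma fset_sq_inv S : fset_sq (fset_inv S) = fset_inv (fset_sq S).
Proof.
apply/fsetP => z; rewrite mem_fset_inv; apply/fset_sqP/fset_sqP.
  case=> [[x y] /=]; rewrite !mem_fset_inv => -[xS yS] ->.
  by exists (y^-1, x^-1); rewrite ?invgM.
case=> [[x y] /= [xS yS] e]; exists (y^-1, x^-1); rewrite /= ?mem_fset_inv ?invgK //.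
by rewrite -invgM -e invgK.
Qed.

Lemma commuting_fset_inv S : commuting_set (fset_inv S) -> commuting_set S.
Proof.
move=> commS x y xS yS; apply: invg_inj; rewrite !invgM.
by apply: commS; rewrite mem_fset_inv invgK.
Qed.

(** Strong induction on the size, splitting off the layer of largest height. Negative heights are
    handled by inversion, and elements of height [0] are translations, which commute. *)
Lemma card_sq_noncommuting (S : {fset G}) :
  1 \in S -> ~ commuting_set S -> (3 * #|` S| <= #|` fset_sq S| + 2)%N.
Proof.
have [m] := ubnP #|` S|; elim: m S => // m IHm S; rewrite ltnS => leSm S1 noncomm.
(* The set [S'] is kept general so that the claim serves both [S] and its inverse set. *)
have pos (S' : {fset G}) y : #|` S'| = #|` S| -> 1 \in S' -> ~ commuting_set S' ->
    y \in S' -> (0 < h y)%R -> (3 * #|` S'| <= #|` fset_sq S'| + 2)%N.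
  move=> cS' S'1 ncS' yS' hy.
  have S'0 : S' != fset0 by apply/fset0Pn; exists 1.
  have [x xS' xmax] := exists_fset_max h S'0.
  have hx : (0 < h x)%R by exact: lt_le_trans hy (xmax _ yS').
  pose T := [fset z in S' | h z != h x]%fset; pose A := [fset z in S' | h z == h x]%fset.
  have S'E : S' = (T `|` A)%fset.
    by apply/fsetP => z; rewrite !inE -andb_orr orNb andbT.
  rewrite S'E; apply: (@card_sq_split (h x)) => //.
  - by apply/fset0Pn; exists x; rewrite !inE xS' eqxx.
  - by rewrite !inE S'1 height1 lt_eqF.
  - by move=> z; rewrite !inE => /andP[zS' hz]; rewrite lt_neqAle hz xmax.
  - by move=> z; rewrite !inE => /andP[_ /eqP].
  - by rewrite -S'E.
  apply: IHm; last by rewrite !inE S'1 height1 lt_eqF.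
  apply: leq_trans leSm; rewrite -cS'; apply/fproper_ltn_card.
  rewrite fproperE; apply/andP; split.
    by apply/fsubsetP => z; rewrite !inE => /andP[].
  by apply/fsubsetPn; exists x; rewrite // !inE xS' eqxx.
have [[y yS hy]|/forall2NP hle0] := pselect (exists2 y, y \in S & (0 < h y)%R).
  exact: pos hy.
have [[y yS hy]|/forall2NP hge0] := pselect (exists2 y, y \in S & (h y < 0)%R).
  rewrite -card_fset_inv -(card_fset_inv (fset_sq S)) -fset_sq_inv.
  apply: (pos _ y^-1).
  - exact: card_fset_inv.
  - by rewrite mem_fset_inv invg1.
  - by move/commuting_fset_inv.
  - by rewrite mem_fset_inv invgK.
  - by rewrite heightV oppr_gt0.
have h0 x : x \in S -> h x = 0%R.
  by move=> xS; case: (hle0 x) (hge0 x) => // + [] //; lia.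
case: noncomm => x y xS yS; apply: ht_inj; first by rewrite !hM addrC.
by rewrite !tM !h0 // !expr0z !mul1r addrC.
Qed.

End AffineGroup.

(** * The affine action of BS(1,q) *)

Section IntegerPowers.
Variable G : groupType.
Implicit Types (x y : G) (m n : int).

Definition zexpg x m : G :=
  match m with Posz n => x ^+ n | Negz n => x ^- n.+1 end.

Lemma zexpg_succ x m : zexpg x (m + 1) = zexpg x m * x.
Proof.
case: m => [n|[|n]]; first by rewrite -PoszD addn1 /= expgSr.
  by rewrite /= mulVg.
have -> : (Negz n.+1 + 1 = Negz n)%R by lia.
by rewrite /= [in RHS]expgS invgM mulgVK.
Qed.

Lemma zexpg_pred x m : zexpg x (m - 1) = zexpg x m * x^-1.
Proof. by rewrite -[in RHS](subrK 1%R m) zexpg_succ mulgK. Qed.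

Lemma zexpgD x m n : zexpg x (m + n) = zexpg x m * zexpg x n.
Proof.
elim/int_rect: n => [|n IHn|n IHn].
- by rewrite addr0 mulg1.
- by rewrite intS (addrC 1%R) addrA !zexpg_succ IHn mulgA.
- by rewrite intS (addrC 1%R) opprD addrA !zexpg_pred IHn mulgA.
Qed.

Lemma zexpg_conj (a b : G) q m :
  a * b = zexpg b q * a -> a * zexpg b m = zexpg b (q * m) * a.
Proof.
move=> ab; have aV : a * b^-1 = zexpg b (- q) * a.
  apply: (mulIg b); rewrite mulgVK -[RHS]mulgA ab mulgA -zexpgD addNr /= mul1g //.
elim/int_rect: m => [|n IHn|n IHn]; first by rewrite mulr0 /= mulg1 mul1g.
  by rewrite intS (addrC 1%R) zexpg_succ mulrDr mulr1 zexpgD mulgA IHn -!mulgA ab.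
rewrite intS (addrC 1%R) opprD zexpg_pred mulrDr mulrN1 zexpgD mulgA IHn -!mulgA.
by rewrite aV.
Qed.

Lemma zexpg_conjX (a b : G) q m j :
  a * b = zexpg b q * a -> a ^+ j * zexpg b m = zexpg b (q ^+ j * m) * a ^+ j.
Proof.
move=> ab; elim: j => [|j IHj]; first by rewrite expr0 mul1r mulg1 mul1g.
by rewrite !expgS -mulgA IHj mulgA (zexpg_conj _ ab) -!mulgA exprS mulrA.
Qed.

End IntegerPowers.

(** * Words as elements of a presented group *)

Section PresentedWords.
Variables (X : choiceType) (R : word X -> word X -> Prop).
Implicit Types (u v w : word X).

Lemma of_word_cat u v : of_word R (u ++ v) = of_word R u * of_word R v.
Proof. exact/esym/pres_mulE. Qed.

Lemma of_word_nil : of_word R [::] = 1. Proof. by []. Qed.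

Lemma of_word_letterV x : of_word R [:: (x, false)] = (of_word R [:: (x, true)])^-1.
Proof. exact/esym/pres_invE. Qed.

Lemma of_word_nseq n l : of_word R (nseq n l) = of_word R [:: l] ^+ n.
Proof. by elim: n => [|n IHn] //; rewrite expgS -IHn -of_word_cat. Qed.

(** The centralizer of [g] is closed under products and inverses, so induction on a representing
    word applies. *)
Lemma presented_commute (g : presented R) :
  (forall x, g * of_word R [:: (x, true)] = of_word R [:: (x, true)] * g) ->
  forall y, g * y = y * g.
Proof.
move=> gX y; rewrite -[y]of_wordK; elim: (repr y) => [|[x b] w IHw].
  by rewrite of_word_nil mulg1 mul1g.
rewrite -cat1s of_word_cat; apply: (@commuteM _ g) => //.
case: b; first exact: gX.
by rewrite of_word_letterV; apply: (@commuteV _ g); exact: gX.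
Qed.

End PresentedWords.

(** * Normal form and faithfulness of the action *)

Section BaumslagSolitar.
Variable q : int.
Local Notation a := (of_word (bs_rel q) [:: (true, true)] : BS q).
Local Notation b := (of_word (bs_rel q) [:: (false, true)] : BS q).

Lemma BS_relation : a * b = zexpg b q * a.
Proof.
have -> : zexpg b q = of_word (bs_rel q) (bs_bpow q).
  case: q => n; rewrite /bs_bpow of_word_nseq //=.
  by rewrite of_word_letterV -expVgn.
rewrite -!of_word_cat; apply/of_wordP; exact/WeqRel/BSRel.
Qed.

Lemma BS_abelian : a * b = b * a -> forall x y : BS q, x * y = y * x.
Proof.
move=> ab x y; apply/esym/presented_commute => z; apply/esym/presented_commute.
by case: z => [[]|[]].
Qed.

(** The factor [a ^+ i] on the left clears negative powers of [a]. Letters are appended on the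
    right, and powers of [b] move left across [a ^+ j] by the relation. *)
Lemma BS_normal_form (x : BS q) :
  exists i j m, a ^+ i * x = zexpg b m * a ^+ j.
Proof.
rewrite -[x]of_wordK; elim/last_ind: (repr x) => [|w l [i [j [m IHw]]]].
  by exists 0, 0, 0%R; rewrite !mulg1.
rewrite -cats1 of_word_cat; case: l => [[] []].
- by exists i, j.+1, m; rewrite mulgA IHw expgSr mulgA.
- rewrite of_word_letterV; case: j IHw => [|j] IHw.
    (* No [a] remains on the right to cancel [a^-1], so one is added on the left:
       [a b^m a^-1 = b^(q m)]. *)
    exists i.+1, 0, (q * m)%R.
    rewrite mulgA expgS -(mulgA a) IHw mulgA.
    by rewrite mulg1 (zexpg_conj _ BS_relation) mulgK mulg1.
  by exists i, j, m; rewrite mulgA IHw expgSr mulgA mulgK.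
- exists i, j, (m + q ^+ j * 1)%R; rewrite mulgA IHw zexpgD -!mulgA.
  by rewrite -(zexpg_conjX _ _ BS_relation).
- exists i, j, (m + q ^+ j * -1)%R; rewrite mulgA IHw zexpgD -!mulgA.
  by rewrite -(zexpg_conjX _ _ BS_relation) of_word_letterV.
Qed.

(* The action on the rationals in which [a] is [x |-> q x] and [b] is [x |-> x + 1];
   a word acts by [x |-> q ^ height w * x + translation w]. *)
Definition letter_height (l : bool * bool) : int :=
  if l.1 then (if l.2 then 1 else -1)%R else 0%R.
Definition letter_translation (l : bool * bool) : rat :=
  if l.1 then 0%R else (if l.2 then 1 else -1)%R.
Definition word_height (w : word bool) : int := (\sum_(l <- w) letter_height l)%R.
Definition word_translation (w : word bool) : rat :=
  foldr (fun l v => letter_translation l + q%:~R ^ letter_height l * v)%R 0%R w.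

Hypothesis q_neq0 : q != 0%R.

Let Q_neq0 : (q%:~R != 0 :> rat)%R. Proof. by rewrite intr_eq0. Qed.

Lemma word_height_cat u v : word_height (u ++ v) = (word_height u + word_height v)%R.
Proof. exact: big_cat. Qed.

Lemma word_translation_cat u v : word_translation (u ++ v) =
  (word_translation u + q%:~R ^ word_height u * word_translation v)%R.
Proof.
elim: u => [|l u IHu]; first by rewrite /word_height big_nil expr0z mul1r add0r.
rewrite /= IHu /word_height big_cons expfzDr //; ring.
Qed.

Lemma word_action_bpow m :
  word_height (bs_bpow m) = 0%R /\ word_translation (bs_bpow m) = m%:~R%R.
Proof.
have aux n c : word_height (nseq n (false, c)) = 0%R /\
    word_translation (nseq n (false, c)) = (letter_translation (false, c) *+ n)%R.
  elim: n => [|n [IHh IHt]]; first by rewrite /word_height big_nil mulr0n.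
  by rewrite /word_height /= big_cons -/(word_height _) IHh IHt expr0z mul1r mulrS.
case: m => n; first exact: aux n true.
by have [-> ->] := aux n.+1 false; rewrite NegzE mulrNz mulNrn.
Qed.

(** This makes the action well defined on the quotient: both sides of the defining relation act as
    [x |-> q x + q]. *)
Lemma word_action_eq u v : word_eq (bs_rel q) u v ->
  word_height u = word_height v /\ word_translation u = word_translation v.
Proof.
elim=> {u v} //.
- by move=> u v _ [-> ->].
- by move=> u v w _ [-> ->] _ [-> ->].
- by move=> u u' v v' _ [eu fu] _ [ev fv];
    rewrite !word_height_cat !word_translation_cat eu fu ev fv.
- move=> [[] []]; rewrite /word_height !big_cons !big_nil /= /letter_height /=;
    split=> //; rewrite /letter_translation /= ?expr0z ?(mulr0, mul1r, addr0, subrr, addNr) //.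
move=> _ _ [].
have [h1 t1] := word_action_bpow 1; have [hq tq] := word_action_bpow q.
rewrite !word_height_cat !word_translation_cat h1 t1 hq tq.
split; first by rewrite addrC.
by rewrite /word_height big_cons big_nil /letter_height /letter_translation /= expr1z expr0z; ring.
Qed.

Definition BS_height (x : BS q) : int := word_height (repr x).
Definition BS_translation (x : BS q) : rat := word_translation (repr x).

Lemma BS_heightE w : BS_height (of_word _ w) = word_height w.
Proof. exact: (word_action_eq (repr_of_word _ w)).1. Qed.

Lemma BS_translationE w : BS_translation (of_word _ w) = word_translation w.
Proof. exact: (word_action_eq (repr_of_word _ w)).2. Qed.

Lemma BS_heightM x y : BS_height (x * y) = (BS_height x + BS_height y)%R.
Proof. by rewrite BS_heightE word_height_cat. Qed.

Lemma BS_translationM x y : BS_translation (x * y) =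
  (BS_translation x + q%:~R ^ BS_height x * BS_translation y)%R.
Proof. by rewrite BS_translationE word_translation_cat. Qed.

Lemma BS_height_a n : BS_height (a ^+ n) = Posz n.
Proof.
rewrite -of_word_nseq BS_heightE /word_height big_nseq.
by elim: n => //= n ->; rewrite /letter_height /=; lia.
Qed.

Lemma BS_translation_a n : BS_translation (a ^+ n) = 0%R.
Proof.
rewrite -of_word_nseq BS_translationE.
by elim: n => //= n ->; rewrite mulr0 addr0.
Qed.

Lemma BS_height_b m : BS_height (zexpg b m) = 0%R.
Proof.
elim/int_rect: m => [|n IHn|n IHn].
- by rewrite (BS_heightE [::]) /word_height big_nil.
- rewrite intS (addrC 1%R) zexpg_succ BS_heightM IHn BS_heightE /word_height big_cons big_nil //.
- rewrite intS (addrC 1%R) opprD zexpg_pred BS_heightM IHn -of_word_letterV BS_heightE.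
  by rewrite /word_height big_cons big_nil.
Qed.

Lemma BS_translation_b m : BS_translation (zexpg b m) = m%:~R%R.
Proof.
elim/int_rect: m => [|n IHn|n IHn].
- by rewrite (BS_translationE [::]).
- rewrite intS (addrC 1%R) zexpg_succ BS_translationM IHn BS_height_b BS_translationE.
  by rewrite intrD expr0z /= /letter_translation /=; lra.
- rewrite intS (addrC 1%R) opprD zexpg_pred BS_translationM IHn -of_word_letterV.
  by rewrite BS_height_b BS_translationE intrD expr0z /= /letter_translation /=; lra.
Qed.

(** The quotient [z] of [x] by [y] acts trivially. In its normal form [a^i z = b^m a^j], heights
    give [j = i] and translations give [m = 0], so [z = 1]. *)
Lemma BS_action_inj x y : BS_height x = BS_height y ->
  BS_translation x = BS_translation y -> x = y.
Proof.
move=> hxy txy; have [z zy] : exists z, x = z * y by exists (x / y); rewrite mulgVK.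
suff z1 : z = 1 by rewrite zy z1 mul1g.
have hz : BS_height z = 0%R.
  by move: hxy; rewrite zy BS_heightM; lia.
have tz : BS_translation z = 0%R.
  by move: txy; rewrite zy BS_translationM hz expr0z; lra.
have [i [j [m e]]] := BS_normal_form z.
have ij : j = i.
  by move/(congr1 BS_height): e; rewrite !BS_heightM BS_height_b !BS_height_a hz; lia.
have m0 : m = 0%R.
  move/(congr1 BS_translation): e.
  rewrite !BS_translationM BS_translation_b !BS_translation_a tz !mulr0 !addr0.
  by move/esym/eqP; rewrite intr_eq0 => /eqP.
by move: e; rewrite ij m0 /= mul1g => /(canRL (mulKg _)); rewrite mulVg.
Qed.

End BaumslagSolitar.

(** Centralizers are subgroups. Applied first to [S] and then to the subgroup it generates, this
    extends commutation from [S] to both factors. *)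
Lemma generated_commute (G : groupType) (S : {fset G}) : commuting_set S ->
  forall u v : G, generated S u -> generated S v -> u * v = v * u.
Proof.
move=> commS.
have centr (X : set G) : group_closed [in [set x | forall y, X y -> x * y = y * x]%classic].
  split=> [|x y]; rewrite !inE /=; first by move=> y _; rewrite mulg1 mul1g.
  move=> Xx Xy z Xz; apply/commute_sym/commuteM; first exact/commute_sym/Xx.
  exact/commuteV/commute_sym/Xy.
have gS u : generated S u -> forall y, y \in S -> u * y = y * u.
  apply: (smallest_sub (centr [set` S]%classic)) => x xS y yS; exact: commS.
move=> u v Su Sv; apply: (smallest_sub (centr (generated S)) _ Su) => // x xS y Sy.
exact/esym/gS.
Qed.

Unset Implicit Arguments.
Set Strict Implicit.

Theorem theorem2p11 (q : int) (hq : q <> (-1)%R)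
    (le : rel (BS q)) (hle : right_order le)
    (S : {fset BS q}) (k : nat) (hk : #|` S| = k) (hk5 : (5 <= k)%N)
    (hmin : is_min le S 1)
    (hS2 : #|` fset_sq S| = (3 * k - 3)%N) :
  (forall u v : BS q, generated S u -> generated S v -> u * v = v * u) \/
  exists x g : BS q,
    [/\ S = (1 |` [fset x * g ^+ i | i in iota 0 (k - 1)])%fset,
        x * g <> g * x
      & forall i : nat, (i <= k - 2)%N -> (x * g ^+ i) ^+ 2 = x ^+ 2].
Proof.
left; apply: generated_commute.
(* For [q = 0] the relation reads [a b = a], hence [b = 1]. *)
have [q0|q0] := eqVneq q 0%R.
  move=> x y _ _; apply: BS_abelian; have := BS_relation q.
  rewrite [X in zexpg _ X]q0 /= mul1g => /(canRL (mulKg _)); rewrite mulVg => ->.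
  by rewrite mul1g mulg1.
have [q1|q1] := eqVneq q 1%R.
  by move=> x y _ _; apply: BS_abelian; have := BS_relation q; rewrite [X in zexpg _ X]q1.
have q_gt1 : (1 < `|q|)%R by lia.
apply: contrapT => noncomm.
have := card_sq_noncommuting q_gt1 (@BS_heightM q q0) (@BS_translationM q q0)
  (@BS_action_inj q q0) hmin.1 noncomm.
(* The bound becomes [3k <= (3k - 3) + 2], which is absurd for [k >= 5]. *)
rewrite hS2 hk; lia.
Qed.
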